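(* Let $d\ge 2$, $N\ge 3$ and $2\le k\le N$ be integers, and let $$T(d,N,k)=\frac{2}{d+1}+\frac{d-1}{d+1}\cdot\frac{(N-k+1)(N-k)}{N(N-1)}.$$ Then there exists a $k$-separable $N$-qudit state $\rho$ on $\mathbb{C}^d_{A_1}\otimes\cdots\otimes\mathbb{C}^d_{A_N}$ such that $$\min_{1\le i<j\le N}F_{ij}^{(N)}(\rho)=T(d,N,k).$$
   Context: An $N$-qudit state is a density operator (positive semidefinite, trace one) on $\mathbb{C}^d_{A_1}\otimes\cdots\otimes\mathbb{C}^d_{A_N}$, each factor being a copy of $\mathbb{C}^d$ with computational basis $\{|0\rangle,\dots,|d-1\rangle\}$. $k$-separability: a pure state (unit vector) $|\psi\rangle$ is $k$-separable if there is a partition $\{P_1,\dots,P_k\}$ of $\{A_1,\dots,A_N\}$ into $k$ nonempty sets with $|\psi\rangle=|\psi_{P_1}\rangle\otimes\cdots\otimes|\psi_{P_k}\rangle$, where $|\psi_{P_t}\rangle$ is a unit vector of the systems in $P_t$. A state $\rho$ is $k$-separable if it is a (finite) convex combination of projectors $|\psi_l\rangle\langle\psi_l|$ with each $|\psi_l\rangle$ a $k$-separable pure state; different $l$ may use different partitions into $k$ sets. Fully entangled fraction: for a two-qudit state $\sigma$ on $\mathbb{C}^d\otimes\mathbb{C}^d$, $f(\sigma)=\max_{|e\rangle}\langle e|\sigma|e\rangle$, the maximum being over all maximally entangled unit vectors $|e\rangle=(V\otimes W)\frac{1}{\sqrt d}\sum_{s=0}^{d-1}|s\rangle\otimes|s\rangle$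 with $V,W$ unitary $d\times d$ matrices. Controlled teleportation fidelity: fix $i\ne j$, and let $K_{ij}=\{A_1,\dots,A_N\}\setminus\{A_i,A_j\}$. For a tensor product $U=\bigotimes_{A\in K_{ij}}U_A$ of $d\times d$ unitaries and an outcome $J\in\{0,\dots,d-1\}^{N-2}$ (with $|J\rangle$ the corresponding computational basis vector of the systems in $K_{ij}$), let $p_{U,J}=\langle J|U\rho_{K_{ij}}U^\dagger|J\rangle$, where $\rho_{K_{ij}}$ is the reduced state (partial trace) of $\rho$ on $K_{ij}$. When $p_{U,J}>0$, let $\sigma^{U,J}_{A_iA_j}=\frac{1}{p_{U,J}}\,\langle J|U\,\rho\,U^\dagger|J\rangle$, a state on $A_iA_j$ (with $U$ and $\langle J|$ acting on the systems $K_{ij}$ only). Define $$f_{ij}^{(N)}(\rho)=\max_{U}\sum_{J}p_{U,J}\,f\big(\sigma^{U,J}_{A_iA_j}\big),\qquad F_{ij}^{(N)}(\rho)=\frac{d\,f_{ij}^{(N)}(\rho)+1}{d+1},$$ where terms with $p_{U,J}=0$ are taken to be $0$ and the maximum is over all such tensor products $U$. (By the known formula $F=(df+1)/(d+1)$ for the maximal standard teleportation fidelity over a two-qudit state, $F_{ij}^{(N)}$ is the maximal average teleportation fidelity between $A_i$ and $A_j$.) *)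

(* Defs.v *)
From mathcomp Require Import all_boot all_order all_algebra.
From mathcomp Require Import all_classical all_reals.
From mathcomp.real_closed Require Import complex mxtens.

Set Implicit Arguments.
Unset Strict Implicit.
Unset Printing Implicit Defensive.

Import Order.TTheory GRing.Theory Num.Theory.
Local Open Scope ring_scope.
Local Open Scope sesquilinear_scope.

(* For a finite type Q of qudits, the computational basis of
   the tensor product of the C^d over Q is indexed by {ffun Q -> 'I_d}; the
   coordinate of the basis vector x is enum_rank x. *)
Notation ket R d Q := 'cV[complex R]_#|{ffun Q -> 'I_d}|.
Notation operator R d Q := 'M[complex R]_#|{ffun Q -> 'I_d}|.

Notation sys S := {t | t \in S}.

Definition restr (d N : nat) (S : {set 'I_N}) (x : {ffun 'I_N -> 'I_d}) :
    {ffun sys S -> 'I_d} :=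
  [ffun t => x (val t)].

Definition unit_vector (R : realType) (n : nat) (v : 'cV[R[i]]_n) : Prop :=
  (v^t* *m v) 0 0 = 1.

Definition expval (R : realType) (n : nat) (A : 'M[R[i]]_n) (v : 'cV[R[i]]_n) :
    R[i] :=
  (v^t* *m A *m v) 0 0.

(* For complex numbers, 0 <= z means that z is real and nonnegative, so this
   positivity implies hermiticity. *)
Definition is_state (R : realType) (n : nat) (rho : 'M[R[i]]_n) : Prop :=
  (forall v : 'cV[R[i]]_n, 0 <= expval rho v) /\ \tr rho = 1.

Definition k_separable_pure (R : realType) (d N k : nat)
    (psi : ket R d 'I_N) : Prop :=
  unit_vector psi /\
  exists P : {set {set 'I_N}}, [/\ finset.partition P [set: 'I_N]%SET, #|P| = k &
    exists phi : forall B : {set 'I_N}, ket R d (sys B),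
      (forall B, B \in P -> unit_vector (phi B)) /\
      forall x : {ffun 'I_N -> 'I_d},
        psi (enum_rank x) 0 =
        \prod_(B in P) phi B (enum_rank (restr B x)) 0].

Definition k_separable (R : realType) (d N k : nat)
    (rho : operator R d 'I_N) : Prop :=
  exists (m : nat) (w : 'I_m -> R) (psi : 'I_m -> ket R d 'I_N),
    [/\ forall l, 0 <= w l, \sum_l w l = 1,
        forall l, k_separable_pure k (psi l) &
        rho = \sum_l (w l)%:C%C *: (psi l *m (psi l)^t*)].

(* The sum has type 'M_(d * d, 1 * 1), which is convertible to 'cV_(d * d). *)
Definition max_entangled (R : realType) (d : nat) (V W : 'M[R[i]]_d) :
    'cV[R[i]]_(d * d) :=
  (V *t W) *m
  ((sqrtC d%:R)^-1 *: \sum_(s < d) (delta_mx s 0 : 'cV_d) *t (delta_mx s 0 : 'cV_d)).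

(* The supremum is a maximum, the unitary group being compact; the real part
   is there for typing only, since <e|sigma|e> is real for a state sigma. *)
Definition fully_entangled_fraction (R : realType) (d : nat)
    (sigma : 'M[R[i]]_(d * d)) : R :=
  sup [set r : R | exists V W : 'M[R[i]]_d,
    [/\ V \is unitarymx, W \is unitarymx &
        r = complex.Re (expval sigma (max_entangled V W))]]%classic.

(* The reduced operator on S: the trace over the qudits outside S. *)
Definition reduced (R : realType) (d N : nat) (S : {set 'I_N})
    (rho : operator R d 'I_N) : operator R d (sys S) :=
  \matrix_(a, b)
    \sum_(x : {ffun 'I_N -> 'I_d} | restr S x == enum_val a)
    \sum_(y : {ffun 'I_N -> 'I_d} |
          (restr S y == enum_val b) && (restr (~: S) x == restr (~: S) y))
      rho (enum_rank x) (enum_rank y).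

Definition tensor_op (R : realType) (d : nat) (Q : finType)
    (U : Q -> 'M[R[i]]_d) : operator R d Q :=
  \matrix_(a, b)
    let x : {ffun Q -> 'I_d} := enum_val a in
    let y : {ffun Q -> 'I_d} := enum_val b in
    \prod_(t : Q) U t (x t) (y t).

Definition controllers (N : nat) (i j : 'I_N) : {set 'I_N} :=
  (~: [set i; j])%SET.

Definition outcome_prob (R : realType) (d N : nat) (i j : 'I_N)
    (rho : operator R d 'I_N) (U : sys (controllers i j) -> 'M[R[i]]_d)
    (J : {ffun sys (controllers i j) -> 'I_d}) : R :=
  complex.Re
    ((tensor_op U *m reduced (controllers i j) rho *m (tensor_op U)^t*)
       (enum_rank J) (enum_rank J)).

(* The operator id (x) <J|U from the N qudits to the pair (A_i, A_j). *)
Definition outcome_op (R : realType) (d N : nat) (i j : 'I_N)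
    (U : sys (controllers i j) -> 'M[R[i]]_d)
    (J : {ffun sys (controllers i j) -> 'I_d}) :
    'M[R[i]]_(d * d, #|{ffun 'I_N -> 'I_d}|) :=
  \matrix_(a, b)
    let x : {ffun 'I_N -> 'I_d} := enum_val b in
    (mxtens_unindex a == (x i, x j))%:R *
    tensor_op U (enum_rank J) (enum_rank (restr (controllers i j) x)).

Definition post_state (R : realType) (d N : nat) (i j : 'I_N)
    (rho : operator R d 'I_N) (U : sys (controllers i j) -> 'M[R[i]]_d)
    (J : {ffun sys (controllers i j) -> 'I_d}) : 'M[R[i]]_(d * d) :=
  ((outcome_prob rho U J)^-1)%:C%C *:
  (outcome_op U J *m rho *m (outcome_op U J)^t*).

(* Again a maximum over a compact set. *)
Definition controlled_fraction (R : realType) (d N : nat) (i j : 'I_N)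
    (rho : operator R d 'I_N) : R :=
  sup [set r : R | exists U : sys (controllers i j) -> 'M[R[i]]_d,
    (forall t, U t \is unitarymx) /\
    r = \sum_(J : {ffun sys (controllers i j) -> 'I_d})
          if 0 < outcome_prob rho U J then
            outcome_prob rho U J *
            fully_entangled_fraction (post_state rho U J)
          else 0]%classic.

Definition controlled_fidelity (R : realType) (d N : nat) (i j : 'I_N)
    (rho : operator R d 'I_N) : R :=
  (d%:R * controlled_fraction i j rho + 1) / (d%:R + 1).

Definition is_minimum (R : realType) (A : set R) (m : R) : Prop :=
  A m /\ lbound A m.

(* Main.v *)
(* The state is the uniform mixture, over the sets T of k-1 "idle" parties, of
   the pure states psi_T in which the parties of T are in |0> and the others
   share a GHZ state.  Here GHZ is taken in the Fourier basis, where it is the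
   uniform superposition of the basis vectors x in (Z/d)^(~: T) with sum x = 0.
   Each psi_T is k-separable for the partition into ~: T and the singletons of T.

   Upper bound: for every U and every maximally entangled e, the squared
   overlap of e with an unnormalised outcome vector phi is at most ||phi||^2, and
   at most ||phi||^2 / d when i or j is idle, because phi is then supported on one row
   or one column of the d x d grid, where e has total weight 1/d.  Summing over
   outcomes, f_ij(rho) is at most q + (1 - q) / d, with q the fraction of the
   sets T avoiding both i and j.

   Lower bound: the controllers measure in the computational basis (U = 1).  After
   outcome J the pair uses the vector e_J = d^(-1/2) sum_{s+t+sum J=0} |s,t>,
   which does not depend on T and attains the bound for all T at once; this
   follows by counting the points of the support of psi_T above each J. *)
Require Import Defs.
From mathcomp Require Import all_boot all_order all_algebra.
From mathcomp Require Import all_classical all_reals.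
From mathcomp.real_closed Require Import complex mxtens.
Import Order.TTheory GRing.Theory Num.Theory.
Local Open Scope ring_scope.
Local Open Scope sesquilinear_scope.

Set Implicit Arguments.
Unset Strict Implicit.
Unset Printing Implicit Defensive.

(** * Inner products, Cauchy-Schwarz on a support, and expectation values *)

Section Inner.
Variable R : realType.
Implicit Types n : nat.

Definition inner n (e v : 'cV[R[i]]_n) : R[i] := (e^t* *m v) 0 0.

Lemma innerE n (e v : 'cV[R[i]]_n) : inner e v = \sum_a (e a 0)^* * v a 0.
Proof. by rewrite /inner mxE; apply: eq_bigr => a _; rewrite !mxE. Qed.

Lemma inner_sqnorm n (v : 'cV[R[i]]_n) : inner v v = \sum_a `|v a 0| ^+ 2.
Proof. by rewrite innerE; apply: eq_bigr => a _; rewrite mulrC -normCK. Qed.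

Lemma inner_ge0 n (v : 'cV[R[i]]_n) : 0 <= inner v v.
Proof. by rewrite inner_sqnorm sumr_ge0 // => a _; rewrite exprn_ge0. Qed.

Lemma inner_conj n (e v : 'cV[R[i]]_n) : (v^t* *m e) 0 0 = (inner e v)^*.
Proof.
rewrite -[LHS]/(inner v e) !innerE rmorph_sum; apply: eq_bigr => a _.
by rewrite rmorphM /= conjCK mulrC.
Qed.

(** Truncating [e] to [A] leaves the inner product unchanged because [v] vanishes off [A];
    Cauchy-Schwarz then applies to the truncated vector. *)
Lemma inner_le_support n (A : pred 'I_n) (e v : 'cV[R[i]]_n) :
  (forall a, ~~ A a -> v a 0 = 0) ->
  `|inner e v| ^+ 2 <= (\sum_(a | A a) `|e a 0| ^+ 2) * inner v v.
Proof.
move=> v0; pose eA : 'cV[R[i]]_n := \col_a (if A a then e a 0 else 0).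
have -> : inner e v = inner eA v.
  rewrite !innerE; apply: eq_bigr => a _; rewrite mxE.
  by case: ifPn => // /v0 ->; rewrite !mulr0.
have -> : \sum_(a | A a) `|e a 0| ^+ 2 = inner eA eA.
  rewrite inner_sqnorm big_mkcond; apply: eq_bigr => a _; rewrite mxE.
  by case: ifP => // _; rewrite normr0 expr0n.
(* [dotmx] is a form on row vectors, hence the adjoints. *)
have dotE (x y : 'cV[R[i]]_n) : dotmx (x^t*) (y^t*) = inner x y.
  by rewrite dotmxE trmxCK.
rewrite -!dotE; exact: (CauchySchwarz (@dotmx R[i] n) (eA^t*) (v^t*)).1.
Qed.

Lemma expval_pure n (v e : 'cV[R[i]]_n) :
  expval (v *m v^t*) e = `|inner e v| ^+ 2.
Proof.
rewrite /expval mulmxA -mulmxA mxE big_ord1 -/(inner e v).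
by rewrite inner_conj -normCK.
Qed.

Lemma expval_sum n (I : finType) (w : I -> R) (A : I -> 'M[R[i]]_n) e :
  expval (\sum_l (w l)%:C%C *: A l) e = \sum_l (w l)%:C%C * expval (A l) e.
Proof.
rewrite /expval mulmx_sumr mulmx_suml summxE; apply: eq_bigr => l _.
by rewrite -scalemxAr -scalemxAl mxE.
Qed.

Lemma mxtrace_pure n (v : 'cV[R[i]]_n) : \tr (v *m v^t*) = inner v v.
Proof. by rewrite mxtrace_mulC [\tr _]big_ord1. Qed.

End Inner.

(** * Maximally entangled vectors and their overlaps *)

Section MaxEntangled.
Variables (R : realType) (d : nat).
Implicit Types V W : 'M[R[i]]_d.

(** A maximally entangled vector is a unitary matrix reshaped into a vector and divided by sqrt d.
    Unit rows and columns of that matrix give weight 1/d on each row and column of the grid. *)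
Lemma max_entangledE V W s t :
  max_entangled V W (mxtens_index (s, t)) 0 = (sqrtC d%:R)^-1 * (V *m W^T) s t.
Proof.
rewrite /max_entangled -scalemxAr mxE; congr (_ * _).
rewrite mulmx_sumr summxE mxE; apply: eq_bigr => r _.
rewrite tensmx_mul -!colE.
have -> : (0 : 'I_1) = mxtens_index (0 : 'I_1, 0 : 'I_1) by apply: val_inj.
by rewrite tensmxE !mxE.
Qed.

Lemma sum_mxtens (F : 'I_(d * d) -> R[i]) :
  \sum_a F a = \sum_s \sum_t F (mxtens_index (s, t)).
Proof.
rewrite pair_big; rewrite (reindex (@mxtens_index d d)) //=.
  by apply: eq_bigr => -[].
exists (@mxtens_unindex d d) => x _; [exact: mxtens_indexK|exact: mxtens_unindexK].
Qed.

Lemma max_entangled_mul_unitary V W :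
  V \is unitarymx -> W \is unitarymx -> V *m W^T \is unitarymx.
Proof. by move=> hV hW; rewrite mul_unitarymx ?trmx_unitary. Qed.

Lemma unitarymx_row_norm (G : 'M[R[i]]_d) (hG : G \is unitarymx) s :
  \sum_t `|G s t| ^+ 2 = 1.
Proof.
move: hG => /unitarymxP /matrixP GG; have := GG s s.
rewrite !mxE eqxx mulr1n => <-; apply: eq_bigr => t _.
by rewrite !mxE -normCK.
Qed.

Lemma max_entangled_sqnorm V W s t :
  `|max_entangled V W (mxtens_index (s, t)) 0| ^+ 2 =
  d%:R^-1 * `|(V *m W^T) s t| ^+ 2.
Proof.
rewrite max_entangledE normrM exprMn; congr (_ * _).
by rewrite normfV ger0_norm ?sqrtC_ge0 ?ler0n // exprVn sqrtCK.
Qed.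

Lemma max_entangled_row_norm V W (hV : V \is unitarymx) (hW : W \is unitarymx) s :
  \sum_t `|max_entangled V W (mxtens_index (s, t)) 0| ^+ 2 = d%:R^-1.
Proof.
under eq_bigr do rewrite max_entangled_sqnorm.
by rewrite -mulr_sumr unitarymx_row_norm ?max_entangled_mul_unitary // mulr1.
Qed.

Lemma max_entangled_col_norm V W (hV : V \is unitarymx) (hW : W \is unitarymx) t :
  \sum_s `|max_entangled V W (mxtens_index (s, t)) 0| ^+ 2 = d%:R^-1.
Proof.
have hG : (V *m W^T)^T \is unitarymx.
  by rewrite trmx_unitary max_entangled_mul_unitary.
under eq_bigr do rewrite max_entangled_sqnorm.
rewrite -mulr_sumr -[RHS]mulr1 -(unitarymx_row_norm hG t).
by congr (_ * _); apply: eq_bigr => s _; rewrite [in RHS]mxE.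
Qed.

Lemma inner_le_pair_support (A : 'I_d -> 'I_d -> bool) (e v : 'cV[R[i]]_(d * d)) :
  (forall s t, ~~ A s t -> v (mxtens_index (s, t)) 0 = 0) ->
  `|inner e v| ^+ 2 <=
    (\sum_s \sum_(t | A s t) `|e (mxtens_index (s, t)) 0| ^+ 2) * inner v v.
Proof.
move=> v0; pose B a := let: (s, t) := mxtens_unindex a in A s t.
have BE s t : B (mxtens_index (s, t)) = A s t by rewrite /B mxtens_indexK.
have -> : \sum_s \sum_(t | A s t) `|e (mxtens_index (s, t)) 0| ^+ 2 =
    \sum_(a | B a) `|e a 0| ^+ 2.
  rewrite [RHS]big_mkcond sum_mxtens; apply: eq_bigr => s _.
  by rewrite big_mkcond; apply: eq_bigr => t _; rewrite BE.
apply: inner_le_support => a; rewrite -(mxtens_unindexK a).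
case: (mxtens_unindex a) => s t.
by rewrite BE; apply: v0.
Qed.

Lemma inner_max_entangled_le V W (hV : V \is unitarymx) (hW : W \is unitarymx)
    (v : 'cV[R[i]]_(d * d)) : (0 < d)%N ->
  `|inner (max_entangled V W) v| ^+ 2 <= inner v v.
Proof.
move=> d_gt0.
have e1 : \sum_s \sum_t `|max_entangled V W (mxtens_index (s, t)) 0| ^+ 2 = 1.
  under eq_bigr do rewrite (max_entangled_row_norm hV hW).
  by rewrite sumr_const card_ord -[_^-1 *+ _]mulr_natr mulVf ?pnatr_eq0 -?lt0n.
rewrite -[leRHS]mul1r -e1.
exact: (inner_le_pair_support (A := fun _ _ => true)).
Qed.

(** This serves the case of an idle [i], where only one value of the first coordinate survives; the
    column version serves an idle [j]. *)
Lemma inner_max_entangled_le_row V W (hV : V \is unitarymx) (hW : W \is unitarymx)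
    (v : 'cV[R[i]]_(d * d)) s0 :
  (forall s t, s != s0 -> v (mxtens_index (s, t)) 0 = 0) ->
  `|inner (max_entangled V W) v| ^+ 2 <= d%:R^-1 * inner v v.
Proof.
move=> v0; rewrite -(max_entangled_row_norm hV hW s0).
apply: le_trans (inner_le_pair_support (A := fun s _ => s == s0) _ _) _ => //.
rewrite ler_wpM2r ?inner_ge0 // (bigD1 s0) //= eqxx [X in _ + X]big1 ?addr0 //.
by move=> s /negPf ss0; rewrite big_pred0 // => t; rewrite ss0.
Qed.

Lemma inner_max_entangled_le_col V W (hV : V \is unitarymx) (hW : W \is unitarymx)
    (v : 'cV[R[i]]_(d * d)) t0 :
  (forall s t, t != t0 -> v (mxtens_index (s, t)) 0 = 0) ->
  `|inner (max_entangled V W) v| ^+ 2 <= d%:R^-1 * inner v v.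
Proof.
move=> v0; rewrite -(max_entangled_col_norm hV hW t0).
apply: le_trans (inner_le_pair_support (A := fun _ t => t == t0) _ _) _ => //.
by rewrite ler_wpM2r ?inner_ge0 // ler_sum // => s _; rewrite big_pred1_eq.
Qed.

End MaxEntangled.

Lemma sum_ket (V : nmodType) (F : finType) (f : 'I_#|F| -> V) :
  \sum_c f c = \sum_(z : F) f (enum_rank z).
Proof.
by rewrite (reindex (@enum_rank F)) //; apply: onW_bij; apply: enum_rank_bij.
Qed.

Lemma sum_fiber (V : nmodType) (I J : finType) (f : I -> J) (P : pred I)
    (G : J -> I -> V) :
  \sum_p \sum_(x | (f x == p) && P x) G p x = \sum_(x | P x) G (f x) x.
Proof.
rewrite (exchange_big_dep P) /=; last by move=> p x _ /andP[].
by apply: eq_bigr => x Px; under eq_bigl do rewrite Px andbT eq_sym;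
   rewrite big_pred1_eq.
Qed.

Lemma adjmxE (C : numClosedFieldType) m n (M : 'M[C]_(m, n)) a b :
  (M^t*) a b = (M b a)^*.
Proof. by rewrite !mxE. Qed.

(** * The controllers' measurement and its outcome operators *)

Section Outcome.
Variables (R : realType) (d N : nat) (i j : 'I_N).
Local Notation K := (controllers i j).
Local Notation conf := {ffun 'I_N -> 'I_d}.
Implicit Types (x y : conf) (J : {ffun sys K -> 'I_d}) (rho : operator R d 'I_N).
Implicit Types (U : sys K -> 'M[R[i]]_d).

Lemma tensor_op_entry (Q : finType) (U : Q -> 'M[R[i]]_d) (x y : {ffun Q -> 'I_d}) :
  tensor_op U (enum_rank x) (enum_rank y) = \prod_t U t (x t) (y t).
Proof. by rewrite mxE !enum_rankK. Qed.

Lemma tensor_op1 (Q : finType) :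
  tensor_op (fun _ : Q => 1%:M : 'M[R[i]]_d) = 1%:M.
Proof.
apply/matrixP => a b; rewrite -(enum_valK a) -(enum_valK b) tensor_op_entry.
rewrite mxE (inj_eq enum_rank_inj).
have [<-|ab] := eqVneq (enum_val a) (enum_val b).
  by apply: big1 => t _; rewrite mxE eqxx.
have [t abt] : exists t, enum_val a t != enum_val b t.
  apply/existsP; apply: contraT; rewrite negb_exists => /forallP h.
  by case/eqP: ab; apply/ffunP => t; apply/eqP; have := h t; rewrite negbK.
by rewrite (bigD1 t) //= mxE (negPf abt) mul0r.
Qed.

Lemma tensor_op_unitary (Q : finType) (U : Q -> 'M[R[i]]_d) :
  (forall t, U t \is unitarymx) -> (tensor_op U)^t* *m tensor_op U = 1%:M.
Proof.
move=> hU; rewrite -tensor_op1; apply/matrixP => a b.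
rewrite -(enum_valK a) -(enum_valK b) tensor_op_entry mxE sum_ket.
set x := enum_val a; set y := enum_val b.
transitivity (\sum_(z : {ffun Q -> 'I_d})
    \prod_t ((U t (z t) (x t))^* * U t (z t) (y t))).
  apply: eq_bigr => z _.
  by rewrite !mxE !enum_rankK rmorph_prod -big_split.
rewrite -(bigA_distr_bigA (fun t r => (U t r (x t))^* * U t r (y t))).
apply: eq_bigr => t _; have /unitarymxP/mulmx1C/matrixP <- := hU t.
by rewrite mxE; apply: eq_bigr => r _; rewrite !mxE.
Qed.

Lemma in_controllers t : (t \in K) = (t != i) && (t != j).
Proof. by rewrite !inE negb_or. Qed.

Lemma restr_eqP (S : {set 'I_N}) x y :
  reflect {in S, x =1 y} (restr S x == restr S y).
Proof.
apply: (iffP eqP) => [/ffunP h t tS|h].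
  by have := h (exist _ t tS); rewrite !ffunE.
by apply/ffunP => t; rewrite !ffunE h // (valP t).
Qed.

Lemma restr_complement_controllers x y :
  (restr (~: K) x == restr (~: K) y) = ((x i, x j) == (y i, y j)).
Proof.
apply/restr_eqP/eqP => [h|[hi hj] t].
  by rewrite !h // !inE eqxx ?orbT.
by rewrite !inE negbK => /orP[]/eqP ->.
Qed.

Lemma restr_controllers_inj x y :
  (restr K x == restr K y) && ((x i, x j) == (y i, y j)) = (x == y).
Proof.
apply/andP/eqP => [[/restr_eqP h /eqP[hi hj]]|-> //].
apply/ffunP => t; have [->|ti] := eqVneq t i; first by [].
have [->|tj] := eqVneq t j; first by [].
by apply: h; rewrite in_controllers ti.
Qed.

Lemma outcome_op_entry U J s t x :
  outcome_op U J (mxtens_index (s, t)) (enum_rank x) =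
  ((s, t) == (x i, x j))%:R *
  tensor_op U (enum_rank J) (enum_rank (restr K x)).
Proof. by rewrite mxE enum_rankK mxtens_indexK. Qed.

Lemma sum_outcome_op U J x y (c : R[i]) :
  \sum_a (outcome_op U J a (enum_rank x) * c * (outcome_op U J a (enum_rank y))^*) =
  ((x i, x j) == (y i, y j))%:R *
  (tensor_op U (enum_rank J) (enum_rank (restr K x)) * c *
   (tensor_op U (enum_rank J) (enum_rank (restr K y)))^*).
Proof.
rewrite sum_mxtens pair_big (bigD1 (x i, x j)) //= big1 => [|[s t] /= st].
  by rewrite !outcome_op_entry eqxx mul1r addr0 rmorphM rmorph_nat mulrCA.
by rewrite !outcome_op_entry (negPf st) !mul0r.
Qed.

(** Summing over [J] gives the inner product of two columns of the unitary [tensor_op U], which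
    forces agreement on the controllers; the indicator in [outcome_op] forces agreement on [i] and
    [j]. Together these say x = y. *)
Lemma outcome_op_complete U : (forall t, U t \is unitarymx) ->
  \sum_J (outcome_op U J)^t* *m outcome_op U J = 1%:M.
Proof.
move=> hU; apply/matrixP => a b; rewrite -(enum_valK a) -(enum_valK b).
set x := enum_val a; set y := enum_val b.
rewrite summxE mxE (inj_eq enum_rank_inj) -restr_controllers_inj.
transitivity (\sum_J ((y i, y j) == (x i, x j))%:R *
  ((tensor_op U (enum_rank J) (enum_rank (restr K x)))^* *
   (tensor_op U (enum_rank J) (enum_rank (restr K y))))).
  apply: eq_bigr => J _; rewrite mxE.
  under eq_bigr do rewrite adjmxE mulrC -[X in X * _]mulr1.
  by rewrite sum_outcome_op mulr1 [X in _ * X]mulrC.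
have /matrixP/(_ (enum_rank (restr K x)) (enum_rank (restr K y))) :=
  tensor_op_unitary hU.
rewrite -mulr_sumr mxE sum_ket mxE (inj_eq enum_rank_inj).
under eq_bigr do rewrite adjmxE.
by move=> ->; rewrite eq_sym mulrC -natrM mulnb.
Qed.

(** Links the probability, defined through the reduced state, to the unnormalised post-measurement
    operator. Both sides expand to one double sum over configurations [x], [y] that agree on the
    pair. *)
Lemma outcome_prob_trace rho U J :
  outcome_prob rho U J =
  complex.Re (\tr (outcome_op U J *m rho *m (outcome_op U J)^t*)).
Proof.
rewrite /outcome_prob; congr complex.Re; set T := tensor_op U.
transitivity (\sum_(y : conf) \sum_(x : conf | (x i, x j) == (y i, y j))
   T (enum_rank J) (enum_rank (restr K x)) * rho (enum_rank x) (enum_rank y)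
   * (T (enum_rank J) (enum_rank (restr K y)))^*).
  clearbody T; rewrite mxE sum_ket.
  transitivity (\sum_q \sum_(y : conf | restr K y == q)
   \sum_(x : conf | (x i, x j) == (y i, y j))
     T (enum_rank J) (enum_rank (restr K x)) * rho (enum_rank x) (enum_rank y)
     * (T (enum_rank J) (enum_rank q))^*); last first.
    by under eq_bigr do under eq_bigl do rewrite -[_ == _]andbT;
       rewrite (@sum_fiber _ _ _ (restr K) predT).
  apply: eq_bigr => q _; rewrite adjmxE mxE sum_ket.
  under [RHS]eq_bigr do rewrite -mulr_suml.
  rewrite -mulr_suml; congr (_ * _).
  under eq_bigr do rewrite [reduced _ _ _ _]mxE !enum_rankK.
  transitivity (\sum_p \sum_(x : conf | (restr K x == p) && true)
    T (enum_rank J) (enum_rank p) *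
    \sum_(y : conf | (restr K y == q) && ((x i, x j) == (y i, y j)))
      rho (enum_rank x) (enum_rank y)).
    apply: eq_bigr => p _; rewrite mulr_sumr; apply: eq_big => [x|x _].
      by rewrite andbT.
    by congr (_ * _); apply: eq_bigl => y; rewrite restr_complement_controllers.
  rewrite sum_fiber; under [LHS]eq_bigr do rewrite /= mulr_sumr.
  rewrite (exchange_big_dep (fun y => restr K y == q)) //=; last first.
    by move=> x y _ /andP[].
  by apply: eq_bigr => y ->.
symmetry; rewrite /mxtrace.
transitivity (\sum_a \sum_(y : conf) \sum_(x : conf) outcome_op U J a (enum_rank x) *
    rho (enum_rank x) (enum_rank y) * (outcome_op U J a (enum_rank y))^*).
  apply: eq_bigr => a _; rewrite mxE sum_ket; apply: eq_bigr => y _.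
  by rewrite mxE sum_ket mulr_suml adjmxE.
rewrite exchange_big; apply: eq_bigr => y _; rewrite exchange_big [RHS]big_mkcond.
apply: eq_bigr => x _; rewrite sum_outcome_op.
by case: ifP; rewrite ?mul1r ?mul0r.
Qed.

Lemma sum_outcome_norm U (hU : forall t, U t \is unitarymx) (psi : ket R d 'I_N) :
  \sum_J inner (outcome_op U J *m psi) (outcome_op U J *m psi) = inner psi psi.
Proof.
rewrite /inner -[X in _ = (_ *m X) _ _]mul1mx -(outcome_op_complete hU).
rewrite mulmx_suml mulmx_sumr summxE; apply: eq_bigr => J _.
by rewrite trmx_mul map_mxM !mulmxA.
Qed.

Lemma outcome_op_mixture (I : finType) (w : I -> R) (psi : I -> ket R d 'I_N) U J :
  outcome_op U J *m (\sum_l (w l)%:C%C *: (psi l *m (psi l)^t*))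
    *m (outcome_op U J)^t* =
  \sum_l (w l)%:C%C *: ((outcome_op U J *m psi l) *m (outcome_op U J *m psi l)^t*).
Proof.
rewrite mulmx_sumr mulmx_suml; apply: eq_bigr => l _.
by rewrite -scalemxAr -scalemxAl trmx_mul map_mxM !mulmxA.
Qed.

End Outcome.

(** * The controlled fraction of a mixture of pure states *)

Section Mixture.
Variable R : realType.

Lemma Re_le (z1 z2 : R[i]) : z1 <= z2 -> complex.Re z1 <= complex.Re z2.
Proof. by rewrite lecE => /andP[]. Qed.

Lemma Re_scale (r : R) (z : R[i]) : complex.Re (r%:C%C * z) = r * complex.Re z.
Proof. by case: z => a b /=; rewrite mul0r subr0. Qed.

Lemma Re_sum (I : finType) (z : I -> R[i]) :
  complex.Re (\sum_l z l) = \sum_l complex.Re (z l).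
Proof. by apply: (big_morph (@complex.Re R)) => // -[? ?] [? ?]. Qed.

Lemma unitarymx1 n : (1%:M : 'M[R[i]]_n) \is unitarymx.
Proof. by apply/unitarymxP; rewrite trmx1 map_mx1 mulmx1. Qed.

Variables (d N : nat) (i j : 'I_N) (I : finType) (w : I -> R).
Variable psi : I -> ket R d 'I_N.
Hypothesis d_gt0 : (0 < d)%N.
Hypothesis w_ge0 : forall l, 0 <= w l.
Local Notation K := (controllers i j).
Implicit Types (J : {ffun sys K -> 'I_d}) (U : sys K -> 'M[R[i]]_d).
Implicit Types (V W : 'M[R[i]]_d).

Let rho : operator R d 'I_N := \sum_l (w l)%:C%C *: (psi l *m (psi l)^t*).
Let phi U J l := outcome_op U J *m psi l.

Lemma outcome_prob_mixture U J :
  outcome_prob rho U J = \sum_l w l * complex.Re (inner (phi U J l) (phi U J l)).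
Proof.
rewrite outcome_prob_trace outcome_op_mixture (raddf_sum (@mxtrace _ _)) Re_sum.
by apply: eq_bigr => l _; rewrite /= mxtraceZ mxtrace_pure Re_scale.
Qed.

(** Weighting by the probability cancels the normalisation of the post-measurement state, so what
    remains is linear in the mixture. *)
Lemma expval_post_state U J e : 0 < outcome_prob rho U J ->
  outcome_prob rho U J * complex.Re (expval (post_state rho U J) e) =
  \sum_l w l * complex.Re (`|inner e (phi U J l)| ^+ 2).
Proof.
move=> p_gt0; rewrite /post_state outcome_op_mixture.
rewrite /expval -scalemxAr -scalemxAl mxE Re_scale mulVKf ?gt_eqF //.
rewrite -/(expval _ _) expval_sum Re_sum; apply: eq_bigr => l _.
by rewrite expval_pure Re_scale.
Qed.

(** Boundedness is stated along with the estimate because a lower bound on the supremum, needed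
    later, requires it. *)
Lemma fully_entangled_fraction_le U J (b : I -> R) : 0 < outcome_prob rho U J ->
  (forall V W l, V \is unitarymx -> W \is unitarymx ->
    `|inner (max_entangled V W) (phi U J l)| ^+ 2 <=
      (b l)%:C%C * inner (phi U J l) (phi U J l)) ->
  has_ubound [set r : R | exists V W : 'M[R[i]]_d,
    [/\ V \is unitarymx, W \is unitarymx &
        r = complex.Re (expval (post_state rho U J) (max_entangled V W))]]%classic /\
  outcome_prob rho U J * fully_entangled_fraction (post_state rho U J) <=
  \sum_l w l * (b l * complex.Re (inner (phi U J l) (phi U J l))).
Proof.
move=> p_gt0 hb; set S := [set r | _]%classic; set M := \sum_l _.
have Sub : ubound S ((outcome_prob rho U J)^-1 * M).
  move=> _ [V [W [hV hW ->]]]; rewrite ler_pdivlMl //.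
  rewrite expval_post_state //; apply: ler_sum => l _.
  by rewrite ler_wpM2l // -Re_scale; apply/Re_le/hb.
split; first by exists ((outcome_prob rho U J)^-1 * M).
rewrite -ler_pdivlMl //; apply: ge_sup => //.
exists (complex.Re (expval (post_state rho U J) (max_entangled 1%:M 1%:M))).
by exists 1%:M, 1%:M; split=> //; apply: unitarymx1.
Qed.

Let outcome_value U J : R :=
  if 0 < outcome_prob rho U J then
    outcome_prob rho U J * fully_entangled_fraction (post_state rho U J)
  else 0.

Lemma outcome_value_ge U J V W : V \is unitarymx -> W \is unitarymx ->
  \sum_l w l * complex.Re (`|inner (max_entangled V W) (phi U J l)| ^+ 2) <=
  outcome_value U J.
Proof.
move=> hV hW; rewrite /outcome_value; case: ifPn => [p_gt0|].
  rewrite -expval_post_state // ler_pM2l //; apply: ub_le_sup; last by exists V, W.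
  have [] // := @fully_entangled_fraction_le U J (fun=> 1) p_gt0.
  by move=> V' W' l hV' hW'; rewrite mul1r inner_max_entangled_le.
(* Here the value is 0 and the probability is at most 0; each squared overlap is at most the squared
   norm, so the left side is at most that probability. *)
rewrite -leNgt; apply: le_trans; rewrite outcome_prob_mixture.
apply: ler_sum => l _; rewrite ler_wpM2l //.
by apply/Re_le/inner_max_entangled_le.
Qed.

Hypothesis psi_unit : forall l, unit_vector (psi l).

(** By completeness the squared norms of the outcome vectors of each unit vector [psi l] sum to 1,
    so the per-outcome bounds add up to the average of [b]. *)
Lemma controlled_value_le (b : I -> R) : (forall l, 0 <= b l) ->
  (forall U J V W l, V \is unitarymx -> W \is unitarymx ->
    `|inner (max_entangled V W) (phi U J l)| ^+ 2 <=
      (b l)%:C%C * inner (phi U J l) (phi U J l)) ->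
  forall U, (forall t, U t \is unitarymx) ->
  \sum_J outcome_value U J <= \sum_l w l * b l.
Proof.
move=> b_ge0 hb U hU.
have -> : \sum_l w l * b l =
    \sum_J \sum_l w l * (b l * complex.Re (inner (phi U J l) (phi U J l))).
  rewrite exchange_big; apply: eq_bigr => l _; rewrite -!mulr_sumr -Re_sum.
  by rewrite sum_outcome_norm // [inner _ _]psi_unit /= mulr1.
apply: ler_sum => J _; rewrite /outcome_value; case: ifPn => [p_gt0|_].
  by have [] := fully_entangled_fraction_le p_gt0 (hb U J).
apply: sumr_ge0 => l _; rewrite !mulr_ge0 //.
by apply: (@Re_le 0); apply: inner_ge0.
Qed.

(** Optimising each component separately only bounds a mixture from above. Equality holds because a
    single [U], with vectors depending on [J] but not on [l], reaches [b l] for every [l] at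
    once. *)
Lemma controlled_fraction_mixture (b : I -> R) U
    (V W : {ffun sys K -> 'I_d} -> 'M[R[i]]_d) : (forall l, 0 <= b l) ->
  (forall U J V W l, V \is unitarymx -> W \is unitarymx ->
    `|inner (max_entangled V W) (phi U J l)| ^+ 2 <=
      (b l)%:C%C * inner (phi U J l) (phi U J l)) ->
  (forall t, U t \is unitarymx) ->
  (forall J, V J \is unitarymx) -> (forall J, W J \is unitarymx) ->
  (forall l, (b l)%:C%C <=
    \sum_J `|inner (max_entangled (V J) (W J)) (phi U J l)| ^+ 2) ->
  controlled_fraction i j rho = \sum_l w l * b l.
Proof.
move=> b_ge0 hb hU hV hW hge; rewrite /controlled_fraction; set S := [set r | _]%classic.
have SU : S (\sum_J outcome_value U J) by exists U.
have Sub : ubound S (\sum_l w l * b l).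
  by move=> _ [U' [hU' ->]]; apply: controlled_value_le.
apply/le_anti/andP; split; first by apply: ge_sup => //; exists (\sum_J outcome_value U J).
apply: le_trans (ub_le_sup _ SU); last by exists (\sum_l w l * b l).
apply: (@le_trans _ _ (\sum_J \sum_l w l * complex.Re
   (`|inner (max_entangled (V J) (W J)) (phi U J l)| ^+ 2))); last first.
  by apply: ler_sum => J _; apply: outcome_value_ge.
rewrite exchange_big; apply: ler_sum => l _; rewrite -mulr_sumr -Re_sum.
by rewrite ler_wpM2l //; apply: (@Re_le (b l)%:C%C).
Qed.

End Mixture.

(** * GHZ states with idle parties, and their separability *)

Section Ghz.
Variables (R : realType) (d' N : nat) (T : {set 'I_N}).
Local Notation d := d'.+1.
Local Notation conf := {ffun 'I_N -> 'I_d}.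
Implicit Types x y : conf.

(* T is the set of idle parties; the sum over t is taken in Z/d. *)
Definition ghz_support : {set conf} :=
  [set x : conf | [forall t in T, x t == 0] && (\sum_t x t == 0)]%SET.

(** The size of the support is never evaluated: it cancels against the fibre counts below. *)
Definition ghz : ket R d 'I_N :=
  \col_a if enum_val a \in ghz_support then (sqrtC #|ghz_support|%:R)^-1 else 0.

Lemma ghz_support_gt0 : (0 < #|ghz_support|)%N.
Proof.
apply/card_gt0P; exists [ffun=> 0]; rewrite inE big1 => [|t _]; last by rewrite ffunE.
by rewrite eqxx andbT; apply/forall_inP => t _; rewrite ffunE.
Qed.

Lemma ghzE x : ghz (enum_rank x) 0 =
  if x \in ghz_support then (sqrtC #|ghz_support|%:R)^-1 else 0.
Proof. by rewrite mxE enum_rankK. Qed.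

Lemma norm_inv_sqrtC_nat n : `|(sqrtC n%:R)^-1 : R[i]| ^+ 2 = n%:R^-1.
Proof. by rewrite normfV ger0_norm ?sqrtC_ge0 ?ler0n // exprVn sqrtCK. Qed.

Lemma unit_uniform (Q : finType) (S : pred Q) m : #|S| = m -> (0 < m)%N ->
  unit_vector (\col_(a < #|Q|) if S (enum_val a) then (sqrtC m%:R)^-1 : R[i] else 0).
Proof.
move=> Sm m_gt0; rewrite /unit_vector -/(inner _ _) inner_sqnorm sum_ket.
transitivity (\sum_(z | S z) (m%:R^-1 : R[i])).
  rewrite [RHS]big_mkcond; apply: eq_bigr => z _; rewrite mxE enum_rankK.
  by case: ifP => _; rewrite ?norm_inv_sqrtC_nat // normr0 expr0n.
by rewrite sumr_const Sm -[_^-1 *+ _]mulr_natr mulVf ?pnatr_eq0 -?lt0n.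
Qed.

Lemma ghz_unit : unit_vector ghz.
Proof. exact: (unit_uniform (S := fun x => x \in ghz_support) _ ghz_support_gt0). Qed.

Lemma sum_ghz_support x : [forall t in T, x t == 0] ->
  \sum_(u : sys (~: T)) restr (~: T) x u = \sum_t x t.
Proof.
move=> /forall_inP xT; rewrite [RHS](bigID [in ~: T]) /= [X in _ + X]big1 => [|t].
  by rewrite addr0 [RHS]big_sub; apply: eq_bigr => u _; rewrite ffunE.
by rewrite inE negbK => /xT /eqP.
Qed.

(** Restriction to the active parties is a bijection between the two sets, since idle coordinates
    are 0. Hence the factor on the block [~: T] carries the same normalisation as [ghz]. *)
Lemma card_ghz_support :
  #|[pred y : {ffun sys (~: T) -> 'I_d} | \sum_u y u == 0]| = #|ghz_support|.
Proof.
rewrite -(card_in_imset (f := restr (~: T))); last first.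
  move=> x y; rewrite !inE => /andP[/forall_inP x0 _] /andP[/forall_inP y0 _].
  move=> /eqP/restr_eqP xy; apply/ffunP => t; have [tT|tT] := boolP (t \in T).
    by rewrite (eqP (x0 t tT)) (eqP (y0 t tT)).
  by apply: xy; rewrite inE.
apply: eq_card => y; rewrite inE; apply/idP/imsetP => [y0|[x]]; last first.
  by rewrite inE => /andP[xT xs] ->; rewrite sum_ghz_support.
(* Extension of [y] by 0 on the idle parties. *)
pose x : conf := [ffun t => if insub t is Some u then y u else 0].
have xy : restr (~: T) x = y.
  by apply/ffunP => u; rewrite !ffunE valK.
have xT : [forall t in T, x t == 0].
  by apply/forall_inP => t tT; rewrite ffunE insubN // inE negbK.
by exists x; rewrite ?xy // inE xT -sum_ghz_support // xy.
Qed.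

Definition ghz_blocks : {set {set 'I_N}} :=
  (~: T |: [set [set t] | t in T])%SET.

Lemma ghz_big_block : (~: T)%SET \notin [set [set t] | t in T]%SET.
Proof.
apply/imsetP => -[t tT /setP/(_ t)]; by rewrite !inE tT eqxx.
Qed.

Lemma card_ghz_blocks : #|ghz_blocks| = #|T|.+1.
Proof. by rewrite cardsU1 ghz_big_block card_imset //; apply: finset.set1_inj. Qed.

Lemma ghz_blocks_partition : (#|T| < N)%N ->
  finset.partition ghz_blocks [set: 'I_N]%SET.
Proof.
move=> TN; apply/and3P; split.
- rewrite finset.eqEsubset finset.subsetT; apply/fintype.subsetP => t _; apply/finset.bigcupP.
  have [tT|tT] := boolP (t \in T); [exists [set t]%SET|exists (~: T)%SET];
    rewrite ?inE ?eqxx ?orbT //.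
  by rewrite imset_f ?orbT.
- apply/finset.trivIsetP => A B; rewrite !inE.
  have dT t : t \in T -> [disjoint [set t] & ~: T]%SET.
    by move=> tT; rewrite disjoints1 inE negbK.
  case/orP=> [/eqP->|/imsetP[t tT ->]]; case/orP=> [/eqP->|/imsetP[u uT ->]] AB.
  + by rewrite eqxx in AB.
  + by rewrite disjoint_sym dT.
  + exact: dT.
  + by rewrite disjoints1 inE; apply: contra AB => /eqP ->.
- rewrite !inE negb_or; apply/andP; split.
    (* The large block is nonempty because fewer than [N] parties are idle. *)
    apply: contraL TN => /eqP T0.
    by rewrite -(finset.setCK T) -T0 finset.setC0 cardsT card_ord ltnn.
  by apply/imsetP => -[t _ /setP/(_ t)]; rewrite !inE eqxx.
Qed.

(** The indicator of the support factors: zero sum on [~: T], times one condition x t = 0 for each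
    idle [t]. *)
Lemma ghz_separable k : #|T| = k.-1 -> (0 < k <= N)%N -> k_separable_pure k ghz.
Proof.
move=> cT /andP[k_gt0 kN]; have TN : (#|T| < N)%N by rewrite cT prednK.
split; first exact: ghz_unit.
exists ghz_blocks; split; first exact: ghz_blocks_partition.
  by rewrite card_ghz_blocks cT prednK.
pose m : nat := #|ghz_support|.
(* [S B] is the support of the factor on block [B], and [c B] below is its size: the zero-sum
   vectors on [~: T], the single vector |0> on a singleton. *)
pose S (B : {set 'I_N}) (y : {ffun sys B -> 'I_d}) :=
  if B == (~: T)%SET then \sum_u y u == 0 else y == [ffun=> 0].
pose c (B : {set 'I_N}) := if B == (~: T)%SET then m else 1%N.
exists (fun B => \col_a if S B (enum_val a) then (sqrtC (c B)%:R)^-1 else 0).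
split=> [B _|x].
  apply: (unit_uniform (S := S B)); rewrite /c /S.
    by case: eqP => [->|_]; [exact: card_ghz_support|exact: card1].
  by case: eqP => // _; exact: ghz_support_gt0.
rewrite ghzE big_setU1 ?ghz_big_block // big_imset /=; last by move=> ? ? _ _ /finset.set1_inj.
rewrite mxE enum_rankK {1}/S {1}/c eqxx.
have -> : \prod_(t in T) (\col_a if S [set t]%SET (enum_val a) then
     (sqrtC (c [set t]%SET)%:R)^-1 else 0) (enum_rank (restr [set t]%SET x)) 0 =
   ([forall t in T, x t == 0])%:R :> R[i].
  have fE t : t \in T -> (\col_a if S [set t]%SET (enum_val a) then
     (sqrtC (c [set t]%SET)%:R)^-1 else 0) (enum_rank (restr [set t]%SET x)) 0 =
     (x t == 0)%:R :> R[i].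
    move=> tT; rewrite mxE enum_rankK /S /c.
    have /negPf -> : [set t]%SET != (~: T)%SET.
      by apply: contraNneq ghz_big_block => <-; apply: imset_f.
    rewrite sqrtC1 invr1; have -> : (restr [set t]%SET x == [ffun=> 0]) = (x t == 0).
      have -> : [ffun=> 0] = restr [set t]%SET ([ffun=> 0] : conf).
        by apply/ffunP => u; rewrite !ffunE.
      apply/restr_eqP/eqP => [/(_ t)|xt u]; first by rewrite ffunE inE; apply.
      by rewrite inE => /eqP ->; rewrite ffunE.
    by case: eqP.
  rewrite (eq_bigr _ fE); have [/forall_inP h|] := boolP [forall t in T, x t == 0].
    by apply: big1 => t /h ->.
  rewrite negb_forall_in => /exists_inP[t tT /negPf xt].
  by rewrite (bigD1 t) //= xt mul0r.
rewrite inE; have [xT|] := boolP [forall t in T, x t == 0]; last by rewrite mulr0.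
by rewrite sum_ghz_support // mulr1.
Qed.

End Ghz.

(** * Upper and lower bounds for one pair and one set of idle parties *)

Section PairBounds.
Variables (R : realType) (d' N : nat) (T : {set 'I_N}) (i j : 'I_N).
Local Notation d := d'.+1.
Local Notation conf := {ffun 'I_N -> 'I_d}.
Local Notation K := (controllers i j).
Local Notation supp := (ghz_support d' T).
Local Notation psi := (ghz R d' T).
Implicit Types (x y : conf) (J : {ffun sys K -> 'I_d}).
Implicit Types (U : sys K -> 'M[R[i]]_d).

Definition pair_fraction : R := if (i \in T) || (j \in T) then d%:R^-1 else 1.

Lemma pair_fraction_ge0 : 0 <= pair_fraction.
Proof. by rewrite /pair_fraction; case: ifP => _; rewrite ?invr_ge0 ?ler0n. Qed.

Lemma outcome_ghz_entry U J s t :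
  (outcome_op U J *m psi) (mxtens_index (s, t)) 0 =
  \sum_(x : conf | (x \in supp) && ((s, t) == (x i, x j)))
     tensor_op U (enum_rank J) (enum_rank (restr K x)) * (sqrtC #|supp|%:R)^-1.
Proof.
rewrite mxE sum_ket [RHS]big_mkcond; apply: eq_bigr => x _.
rewrite outcome_op_entry ghzE; case: (x \in supp); last by rewrite mulr0.
by case: ((s, t) == (x i, x j)); rewrite ?mul1r ?mul0r.
Qed.

(** The controllers' operation does not touch the pair, so an idle member of the pair stays in
    |0>. *)
Lemma outcome_ghz_zero U J s t :
  (i \in T) && (s != 0) || (j \in T) && (t != 0) ->
  (outcome_op U J *m psi) (mxtens_index (s, t)) 0 = 0.
Proof.
move=> st; rewrite outcome_ghz_entry big_pred0 // => x; apply: contraTF st.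
rewrite inE => /andP[/andP[/forall_inP x0 _] /eqP[-> ->]].
by rewrite negb_or !negb_and !negbK; apply/andP; split;
  [case: (boolP (i \in T)) => // /x0|case: (boolP (j \in T)) => // /x0].
Qed.

Lemma inner_outcome_ghz_le U J (V W : 'M[R[i]]_d) :
  V \is unitarymx -> W \is unitarymx ->
  `|inner (max_entangled V W) (outcome_op U J *m psi)| ^+ 2 <=
    pair_fraction%:C%C * inner (outcome_op U J *m psi) (outcome_op U J *m psi).
Proof.
move=> hV hW; rewrite /pair_fraction; have [iT|iT] := boolP (i \in T).
  rewrite /= fmorphV rmorph_nat; apply: (inner_max_entangled_le_row hV hW (s0 := 0)) => //.
  by move=> s t s0; rewrite outcome_ghz_zero // iT s0.
have [jT|jT] := boolP (j \in T).
  rewrite /= fmorphV rmorph_nat; apply: (inner_max_entangled_le_col hV hW (t0 := 0)) => //.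
  by move=> s t t0; rewrite outcome_ghz_zero // jT t0 orbT.
by rewrite mul1r inner_max_entangled_le.
Qed.

Hypothesis ij : i != j.

Lemma sum_pair_controllers x : \sum_t x t = x i + x j + \sum_u restr K x u.
Proof.
rewrite (bigD1 i) //= (bigD1 j) 1?eq_sym //= addrA; congr (_ + _).
transitivity (\sum_(t in K) x t).
  by apply: eq_bigl => t; rewrite in_controllers.
by rewrite [LHS]big_sub; apply: eq_bigr => u _; rewrite ffunE.
Qed.

(** The permutation matrix of t -> -(t + c). With [V] the identity, c the sum of [J], and this
    matrix as [W], [max_entangled] is the vector e_J. *)
Definition anticorrelation (c : 'I_d) : 'M[R[i]]_d :=
  \matrix_(t, s) (s + t + c == 0)%:R.

Lemma anticorrelation_unitary c : anticorrelation c \is unitarymx.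
Proof.
apply/unitarymxP/matrixP => t t'; rewrite !mxE (bigD1 (- (t + c))) //=.
rewrite big1 => [|s st]; last first.
  rewrite !mxE -addrA; have /negPf -> : s + (t + c) != 0.
    by rewrite addr_eq0.
  by rewrite mul0r.
rewrite !mxE addr0 -!addrA addNr eqxx mul1r rmorph_nat addrC subr_eq0.
by rewrite (inj_eq (addIr c)) eq_sym.
Qed.

Definition fibre J : {set conf} := [set x in supp | restr K x == J]%SET.

(** Each support point over [J] has x i + x j + sum J = 0, so it meets a nonzero coefficient of e_J;
    all such points contribute the same amount. *)
Lemma inner_anticorrelation J :
  inner (max_entangled 1%:M (anticorrelation (\sum_u J u)))
    (outcome_op (fun=> 1%:M) J *m psi) =
  (sqrtC d%:R)^-1 * (sqrtC #|supp|%:R)^-1 *+ #|fibre J|.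
Proof.
rewrite innerE sum_mxtens pair_big.
pose e (p : 'I_d * 'I_d) : R[i] :=
  (sqrtC d%:R)^-1 * (p.1 + p.2 + \sum_u J u == 0)%:R.
transitivity (\sum_p \sum_(x : conf | ((x i, x j) == p) && (x \in supp))
    e p * ((J == restr K x)%:R * (sqrtC #|supp|%:R)^-1)).
  apply: eq_bigr => -[s t] _; rewrite outcome_ghz_entry mulr_sumr.
  apply: eq_big => [x|x _]; first by rewrite andbC eq_sym.
  rewrite tensor_op1 [X in _ * (X * _)]mxE (inj_eq enum_rank_inj); congr (_ * _).
  rewrite max_entangledE mul1mx !mxE rmorphM rmorph_nat /= geC0_conj //.
  by rewrite invr_ge0 sqrtC_ge0 ler0n.
rewrite sum_fiber -[RHS]sumr_const [LHS]big_mkcond [RHS]big_mkcond.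
apply: eq_bigr => x _; rewrite [x \in fibre J]inE.
case: ifP => //= x_supp; rewrite eq_sym; case: eqP => [xJ|_].
  have := x_supp; rewrite inE sum_pair_controllers xJ => /andP[_ x0].
  by rewrite /e /= x0 mulr1 mul1r.
by rewrite mul0r mulr0.
Qed.

(* The d shifts of x along the pair keep the sum and the controllers' values. *)
Definition pair_shift x (r : 'I_d) : conf :=
  [ffun t => if t == i then x i + r else if t == j then x j - r else x t].

Lemma restr_pair_shift x r : restr K (pair_shift x r) = restr K x.
Proof.
apply/eqP/restr_eqP => t; rewrite in_controllers ffunE => /andP[/negPf -> /negPf ->].
by [].
Qed.

Lemma pair_shift_supp x r : i \notin T -> j \notin T ->
  x \in supp -> pair_shift x r \in supp.
Proof.
move=> iT jT; rewrite !inE !sum_pair_controllers restr_pair_shift !ffunE eqxx.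
rewrite [j == i]eq_sym (negPf ij) eqxx => /andP[/forall_inP x0 xs].
rewrite addrACA subrr addr0 xs andbT; apply/forall_inP => t tT; rewrite ffunE.
have /negPf -> : t != i by apply: contraNneq iT => <-.
have /negPf -> : t != j by apply: contraNneq jT => <-.
exact: x0.
Qed.

(** A lower bound for the size of a nonempty fibre, equal to d times [pair_fraction]. *)
Definition pair_multiplicity := if (i \in T) || (j \in T) then 1%N else d.

(** The fibre contains [x] itself and, when neither [i] nor [j] is idle, its d shifts, which
    coordinate [i] distinguishes. *)
Lemma card_fibre x : x \in supp -> (pair_multiplicity <= #|fibre (restr K x)|)%N.
Proof.
move=> x_supp; rewrite /pair_multiplicity; case: ifPn => [_|].
  by apply/card_gt0P; exists x; rewrite inE x_supp eqxx.
rewrite negb_or => /andP[iT jT].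
have shift_inj : injective (pair_shift x).
  by move=> r r' /ffunP/(_ i); rewrite !ffunE eqxx => /addrI.
rewrite -[leqLHS]card_ord -(card_imset _ shift_inj); apply: subset_leq_card.
apply/fintype.subsetP => _ /imsetP[r _ ->].
by rewrite inE pair_shift_supp // restr_pair_shift eqxx.
Qed.

(** The sum of squares counts each support point with the size of the fibre through it. *)
Lemma sum_fibre_sqr :
  (#|supp| * pair_multiplicity <= \sum_(J : {ffun sys K -> 'I_d}) #|fibre J| ^ 2)%N.
Proof.
have -> : (\sum_(J : {ffun sys K -> 'I_d}) #|fibre J| ^ 2 =
    \sum_(J : {ffun sys K -> 'I_d})
      \sum_(x : conf | (restr K x == J) && (x \in supp)) #|fibre J|)%N.
  apply: eq_bigr => J _; rewrite sum_nat_const -mulnn; congr (_ * _)%N.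
  by apply: eq_card => x; rewrite [LHS]inE andbC.
by rewrite sum_fiber -sum_nat_const; apply: leq_sum => x; apply: card_fibre.
Qed.

(** Each squared overlap is the squared fibre size over d times the support size, so the count of
    squares gives at least [pair_multiplicity] / d. *)
Lemma sum_inner_anticorrelation_ge :
  pair_fraction%:C%C <=
  \sum_(J : {ffun sys K -> 'I_d}) `|inner (max_entangled 1%:M (anticorrelation (\sum_u J u)))
    (outcome_op (fun=> 1%:M) J *m psi)| ^+ 2.
Proof.
have m_gt0 : 0 < #|supp|%:R :> R[i] by rewrite ltr0n ghz_support_gt0.
have d_gt0 : 0 < d%:R :> R[i] by rewrite ltr0n.
have -> : pair_fraction%:C%C = d%:R^-1 * pair_multiplicity%:R :> R[i].
  rewrite /pair_fraction /pair_multiplicity; case: ifP => _.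
    by rewrite mulr1 fmorphV rmorph_nat.
  by rewrite mulVf ?gt_eqF.
under eq_bigr do rewrite inner_anticorrelation normrMn normrM exprMn_n exprMn
  !norm_inv_sqrtC_nat -[_ *+ _]mulr_natr.
rewrite -mulr_sumr -natr_sum -mulrA ler_pM2l ?invr_gt0 //.
by rewrite ler_pdivlMl // -natrM ler_nat sum_fibre_sqr.
Qed.

End PairBounds.

(** * Averaging over the choice of idle parties *)

Lemma mul_bin_pair N r : (2 <= N)%N ->
  (N * N.-1 * 'C(N.-2, r) = (N - r) * (N.-1 - r) * 'C(N, r))%N.
Proof.
case: N => [|[|n]] //= _; rewrite -mulnA (mul_bin_down n.+1 r) mulnCA.
by rewrite (mul_bin_down n.+2 r) mulnA [((n.+1 - r) * _)%N]mulnC.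
Qed.

Section IdleSets.
Variables (R : realType) (N r : nat).

Definition idle_sets : {set {set 'I_N}} := [set T : {set 'I_N} | #|T| == r]%SET.

Lemma card_idle_sets : #|idle_sets| = 'C(N, r).
Proof. by rewrite card_draws card_ord. Qed.

(** These are exactly the [r]-subsets of the N - 2 controllers. *)
Lemma card_idle_sets_avoiding (i j : 'I_N) : i != j ->
  #|[set T in idle_sets | ~~ ((i \in T) || (j \in T))]%SET| = 'C(N.-2, r).
Proof.
move=> ij; have <- : #|controllers i j| = N.-2.
  by rewrite cardsCs finset.setCK cards2 ij card_ord subn2.
rewrite -cards_draws; apply: eq_card => T; rewrite !inE andbC; congr (_ && _).
apply/norP/fintype.subsetP => [[iT jT] t tT|TK].
  by rewrite in_controllers; apply/andP; split; apply: contraTneq tT => ->.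
by split; apply: contraTN isT => /TK; rewrite in_controllers eqxx ?andbF.
Qed.

Lemma sum_pair_fraction d' (i j : 'I_N) : i != j -> (2 <= N)%N -> (r < N)%N ->
  #|idle_sets|%:R^-1 * \sum_(T in idle_sets) pair_fraction R d' T i j =
  d'.+1%:R^-1 + (1 - d'.+1%:R^-1) *
    ((N%:R - r%:R) * (N%:R - r%:R - 1) / (N%:R * (N%:R - 1))).
Proof.
move=> ij N_ge2 rN.
have := card_idle_sets_avoiding ij.
have : (0 < #|idle_sets|)%N by rewrite card_idle_sets bin_gt0 ltnW.
have -> : \sum_(T in idle_sets) pair_fraction R d' T i j =
    #|idle_sets|%:R * d'.+1%:R^-1 +
    #|[set T in idle_sets | ~~ ((i \in T) || (j \in T))]%SET|%:R * (1 - d'.+1%:R^-1).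
  transitivity (\sum_(T in idle_sets) (d'.+1%:R^-1 +
     if ~~ ((i \in T) || (j \in T)) then 1 - d'.+1%:R^-1 else 0 : R)).
    apply: eq_bigr => T _; rewrite /pair_fraction.
    by case: ifP => _ /=; rewrite ?addr0 // addrC subrK.
  rewrite big_split /= sumr_const -big_mkcondr /= -[_ *+ _]mulr_natl.
  congr (_ + _); rewrite mulr_natl -sumr_const.
  by apply: eq_bigl => T; rewrite !inE.
rewrite card_idle_sets => B_gt0 ->.
have B0 : 'C(N, r)%:R != 0 :> R by rewrite pnatr_eq0 -lt0n.
have N1 : N%:R - 1 = N.-1%:R :> R by rewrite -subn1 natrB // ltnW.
have N0 : N%:R * (N%:R - 1) != 0 :> R.
  by rewrite N1 -natrM pnatr_eq0 -lt0n muln_gt0; case: N N_ge2 => [|[]].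
have -> : 'C(N.-2, r)%:R =
    (N%:R - r%:R) * (N%:R - r%:R - 1) / (N%:R * (N%:R - 1)) * 'C(N, r)%:R :> R.
  rewrite mulrAC; apply: (canRL (mulfK N0)).
  (* Since r < N, the truncated subtractions N - r and N.-1 - r agree with those in [R]. *)
  rewrite [N%:R - r%:R - 1]addrAC N1 -natrB 1?ltnW // -natrB.
    by rewrite -!natrM mulnC mul_bin_pair.
  by rewrite -ltnS prednK // ltnW.
rewrite mulrDr mulKf // [X in _ + X = _]mulrC; congr (_ + _).
by rewrite mulrAC mulfK // mulrC.
Qed.

End IdleSets.

Theorem theorem2 (R : realType) (d N k : nat)
    (hd : (2 <= d)%N) (hN : (3 <= N)%N) (hk : (2 <= k)%N) (hkN : (k <= N)%N) :
  exists rho : operator R d 'I_N,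
    [/\ is_state rho,
        k_separable k rho &
        is_minimum
          [set F : R | exists i j : 'I_N,
             (i < j)%N /\ F = controlled_fidelity i j rho]%classic
          (2 / (d%:R + 1) +
           (d%:R - 1) / (d%:R + 1) *
           ((N%:R - k%:R + 1) * (N%:R - k%:R) / (N%:R * (N%:R - 1))))].
Proof.
(* The successor form gives the index type of the basis its addition modulo d. *)
case: d hd => [//|d' _]; set v := (2 / _ + _).
have k_gt0 : (0 < k)%N by exact: ltnW.
(* k - 1 idle singletons and one shared block make k blocks; the sets are enumerated by ordinals as
   [k_separable] requires. *)
pose D := idle_sets N k.-1; pose T (l : 'I_#|D|) : {set 'I_N} := enum_val l.
have cardT l : #|T l| = k.-1 by have := enum_valP l; rewrite inE => /eqP.
have D_gt0 : (0 < #|D|)%N by rewrite card_idle_sets bin_gt0 (leq_trans (leq_pred k)).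
pose w (l : 'I_#|D|) : R := #|D|%:R^-1; pose psi l := ghz R d' (T l).
have w_ge0 l : 0 <= w l by rewrite invr_ge0 ler0n.
have w1 : \sum_l w l = 1.
  by rewrite sumr_const card_ord -[_ *+ _]mulr_natr mulVf // pnatr_eq0 -lt0n.
pose rho := \sum_l (w l)%:C%C *: (psi l *m (psi l)^t*).
(* By symmetry of the mixture all pairs have the same fidelity, which is therefore the minimum. *)
have rhoF i j : i != j -> controlled_fidelity i j rho = v.
  move=> ij; rewrite /controlled_fidelity.
  have -> := @controlled_fraction_mixture R d'.+1 N i j _ w psi isT w_ge0
    (fun l => ghz_unit R d' (T l)) (fun l => pair_fraction R d' (T l) i j)
    (fun=> 1%:M) (fun=> 1%:M) (fun J => anticorrelation R (\sum_u J u)).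
  - rewrite -mulr_sumr -(big_enum_val (fun A => pair_fraction R d' A i j)).
    rewrite sum_pair_fraction // ?prednK // 1?ltnW //.
    (* With r = k - 1, N - r becomes N - k + 1; then d (1/d + (1 - 1/d) q) + 1 = 2 + (d - 1) q. *)
    have -> : k.-1%:R = k%:R - 1 :> R by rewrite -subn1 natrB.
    rewrite opprB [1 - k%:R]addrC addrA addrK /v.
    have d0 : d'.+1%:R != 0 :> R by rewrite pnatr_eq0.
    set q := (_ * _ / (N%:R * _)).
    rewrite mulrDr [_ * (_ * q)]mulrA [_ * (1 - _)]mulrBr mulr1 mulfV //.
    by rewrite addrAC mulrDl [_ * q / _]mulrAC.
  - by move=> l; apply: pair_fraction_ge0.
  - by move=> *; apply: inner_outcome_ghz_le.
  - by move=> *; apply: unitarymx1.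
  - by move=> *; apply: unitarymx1.
  - by move=> *; apply: anticorrelation_unitary.
  - by move=> l; apply: sum_inner_anticorrelation_ge.
exists rho; split.
- split=> [e|].
    rewrite expval_sum sumr_ge0 // => l _.
    by rewrite mulr_ge0 ?ler0c // expval_pure exprn_ge0.
  rewrite (raddf_sum (@mxtrace _ _)) /=.
  under eq_bigr do rewrite mxtraceZ mxtrace_pure [inner _ _]ghz_unit mulr1.
  by rewrite -rmorph_sum w1.
- exists #|D|, w, psi; split=> // l.
  by apply: ghz_separable; rewrite ?cardT ?k_gt0.
- have i0 : (0 < N)%N by exact: leq_trans hN.
  have i1 : (1 < N)%N by exact: leq_trans hN.
  split; first by exists (Ordinal i0), (Ordinal i1); rewrite rhoF.
  by move=> _ [i [j [ij ->]]]; rewrite rhoF // neq_ltn ij.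
Qed.
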